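(* Assume that for every $\lambda\in\mathbb{R}^m$ the point $\bar z(\lambda)\in Z$ satisfies $$\min_{z\in Z}\langle \nabla\mathcal{L}_\rho(\bar z(\lambda),\lambda),\, z-\bar z(\lambda)\rangle \ge -\left(1+\sqrt{2L_{\mathrm p}}\,R_{\mathrm p}\right)\varepsilon_{\mathrm{in}} .$$ Let $(\lambda_k)_{k\ge0}$ be generated from $\lambda_0\in\mathbb{R}^m$ by $$\lambda_{k+1}=\lambda_k+\alpha_k\nabla\bar d_\rho(\lambda_k),\qquad \alpha_k\in[\underline L^{-1},L_{\mathrm d}^{-1}],$$ and let $S_k=\sum_{j=0}^k\alpha_j$, $\bar z_j=\bar z(\lambda_j)$ and $\hat z_k=S_k^{-1}\sum_{j=0}^k\alpha_j\bar z_j$. Then for every $k\ge1$ $$\|A\hat z_k-b\|\le \nu(k,\varepsilon_{\mathrm{in}}),\qquad \nu(k,\varepsilon_{\mathrm{in}}):=\frac{2\underline L R_{\mathrm d}}{k+1}+\sqrt{\frac{2\underline L\left(1+\sqrt{2L_{\mathrm p}}\,R_{\mathrm p}\right)\varepsilon_{\mathrm{in}}}{k+1}},$$ where $R_{\mathrm d}=\|\lambda_0-\lambda^*\|$.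
   Context: Setting: $f:\mathbb{R}^n\to\mathbb{R}$ is convex and differentiable, $A\in\mathbb{R}^{m\times n}$ has full row rank, $b\in\mathbb{R}^m$, $Z\subset\mathbb{R}^n$ is nonempty, compact and convex, $\rho>0$, $\varepsilon_{\mathrm{in}}>0$; $\|\cdot\|$ and $\langle\cdot,\cdot\rangle$ are the Euclidean norm and inner product. Primal problem: $f^*=\min\{f(z): Az=b,\ z\in Z\}$. Augmented Lagrangian: $\mathcal{L}_\rho(z,\lambda)=f(z)+\langle\lambda,Az-b\rangle+\frac\rho2\|Az-b\|^2$; $\nabla\mathcal{L}_\rho$ denotes its gradient in $z$, assumed Lipschitz continuous in $z$ on $\mathbb{R}^n$ with constant $L_{\mathrm p}>0$ for each $\lambda$. $R_{\mathrm p}=\max_{z,y\in Z}\|z-y\|$. Augmented dual function: $d_\rho(\lambda)=\min_{z\in Z}\mathcal{L}_\rho(z,\lambda)$. Slater's constraint qualification is assumed, so that $f^*=\max_{\lambda}\min_{z\in Z}\{f(z)+\langle\lambda,Az-b\rangle\}$; $\lambda^*$ denotes a maximizer of this dual problem (the ordinary dual and the problem $\max_\lambda d_\rho(\lambda)$ have the same optimal value and the same optimal solutions). $L_{\mathrm d}=1/\rho$ and $\underline L\ge L_{\mathrm d}$ is a fixed constant. Inexact dual information: for each $\lambda$ an approximate minimizer $\bar z(\lambda)\in Z$ of $\mathcal{L}_\rho(\cdot,\lambda)$ over $Z$ is fixed, and $\nabla\bar d_\rho(\lambda):=A\bar z(\lambda)-b$ (a notation, not necessarily a gradient). *)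

(* Defs.v *)
From HB Require Import structures.
From mathcomp Require Import all_boot all_order all_algebra.
From mathcomp Require Import all_classical all_reals all_analysis.

Set Implicit Arguments.
Unset Strict Implicit.
Unset Printing Implicit Defensive.

Import Order.TTheory GRing.Theory Num.Theory.
Import numFieldNormedType.Exports.

Local Open Scope classical_set_scope.
Local Open Scope ring_scope.

Section Euclidean.
Context {R : realType} {n : nat}.
Implicit Types (u v x : 'cV[R]_n) (S : set 'cV[R]_n).

Definition dot u v : R := \sum_(i < n) u i 0 * v i 0.

(* The library norm `|u| on matrices is the sup norm; it induces the same
   topology (hence the same compact sets and the same notion of
   differentiability), but every norm in the statement is this one. *)
Definition enorm u : R := Num.sqrt (dot u u).

Definition grad (g : 'cV[R]_n -> R) x : 'cV[R]_n :=
  \col_(i < n) 'D_(delta_mx i 0) g x.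

(* Over a nonempty compact Z and for a continuous g, as in all uses below, the
   infimum and supremum are a minimum and a maximum; in general they follow the
   library convention for inf and sup. *)
Definition min_over (Z : set 'cV[R]_n) (g : 'cV[R]_n -> R) : R :=
  inf [set g z | z in Z].

Definition diameter (Z : set 'cV[R]_n) : R :=
  sup [set enorm (z - y) | z in Z & y in Z].

Definition affine_set S : Prop :=
  forall x y (t : R), S x -> S y -> S ((1 - t) *: x + t *: y).

Definition affine_hull S : set 'cV[R]_n := smallest affine_set S.

Definition relint S : set 'cV[R]_n :=
  [set x | S x /\ \forall y \near x, affine_hull S y -> S y].

End Euclidean.

Section Problem.
Context {R : realType} {m n : nat}.
Variables (f : 'cV[R]_n -> R) (A : 'M[R]_(m, n)) (b : 'cV[R]_m).
Variables (Z : set 'cV[R]_n).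
Implicit Types (z : 'cV[R]_n) (lambda : 'cV[R]_m).

Definition slater : Prop := exists2 z, relint Z z & A *m z = b.

Definition lagrangian z lambda : R := f z + dot lambda (A *m z - b).

Definition dual lambda : R := min_over Z (lagrangian ^~ lambda).

Definition dual_optimal lambda_star : Prop :=
  forall lambda, dual lambda <= dual lambda_star.

Definition aug_lagrangian (rho : R) z lambda : R :=
  f z + dot lambda (A *m z - b) + rho / 2 * enorm (A *m z - b) ^+ 2.

Definition grad_aug_lagrangian (rho : R) z lambda : 'cV[R]_n :=
  grad (aug_lagrangian rho ^~ lambda) z.

(* Not the gradient of anything in general, despite the name. *)
Definition inexact_dual_grad (zbar : 'cV[R]_m -> 'cV[R]_n) lambda : 'cV[R]_m :=
  A *m zbar lambda - b.

End Problem.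

Section Iterates.
Context {R : realType} {m n : nat}.
Variables (zbar : 'cV[R]_m -> 'cV[R]_n) (alpha : nat -> R).
Variables (lambda : nat -> 'cV[R]_m).

Definition stepsum (k : nat) : R := \sum_(j < k.+1) alpha j.

Definition zhat (k : nat) : 'cV[R]_n :=
  (stepsum k)^-1 *: \sum_(j < k.+1) alpha j *: zbar (lambda j).

End Iterates.

Definition inexactness {R : realType} (Lp Rp eps_in : R) : R :=
  (1 + Num.sqrt (2 * Lp) * Rp) * eps_in.

Definition nu {R : realType} (Lund Lp Rp Rd : R) (k : nat) (eps_in : R) : R :=
  2 * Lund * Rd / k.+1%:R
  + Num.sqrt (2 * Lund * inexactness Lp Rp eps_in / k.+1%:R).

(* Main.v *)
(** Write [g_j = A zbar_j - b].  The gradient of the augmented Lagrangian at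
    [(x, mu)] is that of the ordinary Lagrangian at [mu + rho (A x - b)], so
    testing the inexact optimality condition against a feasible minimizer of
    the Lagrangian at [lambda_star] gives
    [<lambda_j - lambda_star, g_j> + rho |g_j|^2 <= eps].  As [alpha_j <= rho],
    this yields
    [|lambda_(j+1) - lambda_star|^2 <= |lambda_j - lambda_star|^2 + 2 alpha_j eps],
    hence [|lambda_(k+1) - lambda_0| <= 2 Rd + sqrt (2 S_k eps)].  Since
    [lambda_(k+1) - lambda_0 = S_k (A zhat_k - b)] and [S_k >= (k+1) / Lund],
    the bound follows on dividing by [S_k]. *)

Require Import Defs.
From HB Require Import structures.
From mathcomp Require Import all_boot all_order all_algebra.
From mathcomp Require Import all_classical all_reals all_analysis.
From mathcomp Require Import ring lra.
Import Order.TTheory GRing.Theory Num.Theory.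
Import numFieldNormedType.Exports.
Local Open Scope classical_set_scope.
Local Open Scope ring_scope.

(** * Euclidean inner product and norm *)

Section Dot.
Context {R : realType} {n : nat}.
Implicit Types (u v w : 'cV[R]_n) (t : R).

Lemma dotC u v : dot u v = dot v u.
Proof. by apply: eq_bigr => i _; rewrite mulrC. Qed.

Lemma dotDl u v w : dot (u + v) w = dot u w + dot v w.
Proof.
by rewrite /dot -big_split; apply: eq_bigr => i _ /=; rewrite mxE mulrDl.
Qed.

Lemma dotZl t u v : dot (t *: u) v = t * dot u v.
Proof. by rewrite /dot mulr_sumr; apply: eq_bigr => i _; rewrite mxE mulrA. Qed.

Lemma dotDr u v w : dot u (v + w) = dot u v + dot u w.
Proof. by rewrite !(dotC u) dotDl. Qed.

Lemma dotZr t u v : dot u (t *: v) = t * dot u v.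
Proof. by rewrite !(dotC u) dotZl. Qed.

Lemma dotNl u v : dot (- u) v = - dot u v.
Proof. by rewrite -scaleN1r dotZl mulN1r. Qed.

Lemma dotNr u v : dot u (- v) = - dot u v.
Proof. by rewrite !(dotC u) dotNl. Qed.

Definition dotE := (dotDl, dotDr, dotNl, dotNr, dotZl, dotZr).

Lemma dot0r u : dot u 0 = 0.
Proof. by rewrite -(scale0r 0) dotZr mul0r. Qed.

Lemma dotvv_ge0 u : 0 <= dot u u.
Proof. by apply: sumr_ge0 => i _; rewrite -expr2 sqr_ge0. Qed.

Lemma dotvv_eq0 u : dot u u = 0 -> u = 0.
Proof.
move=> /eqP; rewrite psumr_eq0 => [/allP u0|i _]; last by rewrite -expr2 sqr_ge0.
apply/colP => i; rewrite mxE; apply/eqP.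
by have := u0 i (mem_index_enum _); rewrite /= mulf_eq0 orbb.
Qed.

Lemma enorm_ge0 u : 0 <= enorm u.
Proof. exact: sqrtr_ge0. Qed.

Lemma sqr_enorm u : enorm u ^+ 2 = dot u u.
Proof. by rewrite sqr_sqrtr ?dotvv_ge0. Qed.

Lemma enormZ t u : 0 <= t -> enorm (t *: u) = t * enorm u.
Proof.
move=> t0; rewrite /enorm !dotE mulrA -expr2 sqrtrM ?sqr_ge0//.
by rewrite sqrtr_sqr ger0_norm.
Qed.

Lemma enormN u : enorm (- u) = enorm u.
Proof. by rewrite /enorm !dotE opprK. Qed.

(** Cauchy-Schwarz: the squared norm of [dot v v *: u - dot u v *: v] is [dot v v] times the
    difference of the two sides, so that factor cancels unless [v] is zero. *)
Lemma sqr_dot_le u v : dot u v ^+ 2 <= dot u u * dot v v.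
Proof.
have [v0|v0] := eqVneq (dot v v) 0.
  by rewrite (dotvv_eq0 v v0) !dot0r expr0n mulr0.
have vgt0 : 0 < dot v v by rewrite lt_neqAle eq_sym v0 dotvv_ge0.
have := dotvv_ge0 (dot v v *: u - dot u v *: v).
rewrite !dotE (dotC v u) => h.
rewrite -(ler_pM2l vgt0).
nra.
Qed.

Lemma dot_le_enorm u v : dot u v <= enorm u * enorm v.
Proof.
rewrite (le_trans (ler_norm _))// -sqrtr_sqr -sqrtrM ?dotvv_ge0//.
by rewrite ler_wsqrtr// sqr_dot_le.
Qed.

Lemma enormD u v : enorm (u + v) <= enorm u + enorm v.
Proof.
rewrite -(@ler_pXn2r _ 2)// ?nnegrE ?addr_ge0 ?enorm_ge0//.
have := dot_le_enorm u v.
rewrite sqrrD !sqr_enorm !dotE (dotC v u).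
lra.
Qed.

End Dot.

(** * Differentiability, minima over compact sets, one-sided derivative bounds *)

Section Derivatives.
Context {R : realType} {n : nat}.
Implicit Types (u v x z : 'cV[R]_n) (g : 'cV[R]_n -> R).

Lemma dot_grad g x v : differentiable g x -> dot (grad g x) v = 'D_v g x.
Proof.
move=> dg; rewrite deriveE// [in RHS](matrix_sum_delta v) linear_sum /=.
apply: eq_bigr => i _; rewrite big_ord1 linearZ /= mxE deriveE//.
by rewrite mulrC.
Qed.

Lemma differentiable_dot k (c : 'cV[R]_k) (h : 'cV[R]_n -> 'cV[R]_k) x :
  (forall i, differentiable (fun z => h z i 0 : R) x) ->
  differentiable (fun z => dot c (h z)) x.
Proof.
move=> dh; rewrite (_ : (fun z => _) = \sum_(i < k) (fun z => c i 0 * h z i 0)).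
  apply: differentiable_sum => i.
  by apply: differentiableM; [exact: differentiable_cst|exact: dh].
by apply/funext => z; rewrite fct_sumE.
Qed.

Lemma differentiable_dotvv k (h : 'cV[R]_n -> 'cV[R]_k) x :
  (forall i, differentiable (fun z => h z i 0 : R) x) ->
  differentiable (fun z => dot (h z) (h z)) x.
Proof.
move=> dh; rewrite (_ : (fun z => _) = \sum_(i < k) (fun z => h z i 0 * h z i 0)).
  by apply: differentiable_sum => i; apply: differentiableM; exact: dh.
by apply/funext => z; rewrite fct_sumE.
Qed.

Lemma differentiable_affine_coord m (A : 'M[R]_(m, n)) (b : 'cV[R]_m) i x :
  differentiable (fun z => (A *m z - b) i 0 : R) x.
Proof.
rewrite (_ : (fun z => _) =
  (fun z : 'cV[R]_n => dot (row i A)^T z) + cst (- b i 0)).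
  apply: differentiableD; last exact: differentiable_cst.
  by apply: differentiable_dot => j; exact: differentiable_coord.
apply/funext => z; rewrite /cst !mxE /=; congr (_ + _).
by apply: eq_bigr => j _; rewrite !mxE.
Qed.

(** Continuity on a compact set bounds the values from below, so that [inf] is a genuine lower bound
    and not a default value. *)
Lemma min_over_le (Z : set 'cV[R]_n) g z :
  compact Z -> (forall x, differentiable g x) -> Z z -> min_over Z g <= g z.
Proof.
move=> cZ dg Zz; apply: ge_inf; last by exists z.
have cg : {within Z, continuous g}.
  by apply: continuous_subspaceT => x; exact: differentiable_continuous.
have [c _ gc] := compact_EVT_min (ex_intro _ z Zz) cZ cg.
by exists (g c) => _ [y Zy <-]; rewrite gc ?inE.
Qed.

Lemma min_over_dot_le (Z : set 'cV[R]_n) (c y z : 'cV[R]_n) :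
  compact Z -> Z z -> min_over Z (fun x => dot c (x - y)) <= dot c (z - y).
Proof.
move=> cZ; apply: (min_over_le Z (fun x => dot c (x - y))) => // x.
apply: differentiable_dot => i.
have := differentiable_affine_coord _ 1%:M y i x.
by under eq_fun do rewrite mul1mx.
Qed.

(** The difference quotient minus [t * c] is at most [D] for small positive [t], and the correction
    vanishes as [t] tends to 0 from the right. *)
Lemma derive_le_of_quadratic_bound g x v (D c : R) :
  derivable g x v ->
  (forall t, 0 < t <= 1 -> g (t *: v + x) <= g x + t * D + t ^+ 2 * c) ->
  'D_v g x <= D.
Proof.
move=> dg gle.
have ct : t * c @[t --> (0 : R)^'+] --> (0 : R).
  apply: cvg_at_right_filter; rewrite -[X in _ --> X](mul0r c).
  by apply: cvgM; [exact: cvg_id|exact: cvg_cst].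
have quot_cvg := cvgB (cvg_dnbhs_at_right dg) ct.
rewrite subr0 in quot_cvg; apply: (cvgr_to_le (quot_cvg _)).
near=> t.
have t0 : 0 < t by near: t; exact: nbhs_right_gt.
have t1 : t <= 1 by near: t; exact: nbhs_right_le.
change (t^-1 * (g (t *: v + x) - g x) - t * c <= D).
rewrite lerBlDr ler_pdivrMl//.
have := gle t; rewrite t0 t1 => /(_ isT).
lra.
Unshelve. all: by end_near. Qed.

Lemma derive_ge0_of_min g x v :
  derivable g x v -> (forall t, 0 < t <= 1 -> g x <= g (t *: v + x)) ->
  0 <= 'D_v g x.
Proof.
move=> dg gle.
apply: (cvgr_to_ge (cvg_dnbhs_at_right dg)).
near=> t.
have t0 : 0 < t by near: t; exact: nbhs_right_gt.
have t1 : t <= 1 by near: t; exact: nbhs_right_le.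
change (0 <= t^-1 * (g (t *: v + x) - g x)).
by rewrite mulr_ge0 ?invr_ge0 ?(ltW t0)// subr_ge0 gle// t0 t1.
Unshelve. all: by end_near. Qed.

End Derivatives.

(** * Convexity along segments *)

Section ConvexSegments.
Context {R : realType} {n : nat}.
Implicit Types (x z : 'cV[R]_n) (t : R).

(** The point is written [t *: (z - x) + x] to match the difference quotient of the derivative at
    [x] in direction [z - x]. *)
Lemma convex_set_segment (Z : set 'cV[R]_n) x z t :
  convex_set Z -> Z x -> Z z -> 0 < t <= 1 -> Z (t *: (z - x) + x).
Proof.
move=> cZ Zx Zz /andP[/ltW t0 t1].
have := cZ z x (Itv01 t0 t1); rewrite !inE => /(_ Zz Zx).
congr Z; rewrite -[LHS]/(t *: z + (1 - t) *: x).
by rewrite scalerBr scalerBl scale1r addrCA addrC.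
Qed.

Lemma convex_function_segment (f : 'cV[R]_n -> R) x z t :
  convex_function [set: 'cV[R]_n] f -> 0 < t <= 1 ->
  f (t *: (z - x) + x) <= f x + t * (f z - f x).
Proof.
move=> cf /andP[/ltW t0 t1].
have : f (t *: z + (1 - t) *: x) <= t * f z + (1 - t) * f x.
  by apply: (cf (Itv01 t0 t1) z x); rewrite inE.
rewrite (_ : t *: z + _ = t *: (z - x) + x); last first.
  by rewrite scalerBr scalerBl scale1r addrCA addrC.
lra.
Qed.

End ConvexSegments.

(** * Lagrangian duality and the inexact optimality condition *)

Section Duality.
Context {R : realType} {m n : nat}.
Variables (f : 'cV[R]_n -> R) (A : 'M[R]_(m, n)) (b : 'cV[R]_m).
Variables (Z : set 'cV[R]_n) (rho : R).
Hypothesis convex_f : convex_function [set: 'cV[R]_n] f.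
Hypothesis diff_f : forall z, differentiable f z.
Hypothesis compact_Z : compact Z.
Hypothesis convex_Z : convex_set Z.
Hypothesis rho_gt0 : 0 < rho.
Implicit Types (x z : 'cV[R]_n) (mu : 'cV[R]_m).

Lemma differentiable_lagrangian mu x :
  differentiable (lagrangian f A b ^~ mu) x.
Proof.
apply: differentiableD; first exact: diff_f.
by apply: differentiable_dot => i; exact: differentiable_affine_coord.
Qed.

Lemma differentiable_aug_lagrangian mu x :
  differentiable (aug_lagrangian f A b rho ^~ mu) x.
Proof.
apply: differentiableD; first exact: differentiable_lagrangian.
apply: differentiableM; first exact: differentiable_cst.
under eq_fun do rewrite sqr_enorm.
by apply: differentiable_dotvv => i; exact: differentiable_affine_coord.
Qed.

(* The gradient of the augmented Lagrangian at [(x, mu)] is that of the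
   ordinary Lagrangian at the shifted multiplier [mu + rho (A x - b)]. *)
Lemma derive_aug_lagrangian_le mu x z :
  'D_(z - x) (aug_lagrangian f A b rho ^~ mu) x <=
  lagrangian f A b z (mu + rho *: (A *m x - b)) -
  lagrangian f A b x (mu + rho *: (A *m x - b)).
Proof.
(* Along the segment from [x] to [z], [f] stays below its chord and the multiplier term is affine;
   the quadratic constant is the second-order term of the penalty. *)
apply: (@derive_le_of_quadratic_bound _ _ _ _ _ _
  (rho / 2 * dot (A *m (z - x)) (A *m (z - x)))).
  exact/diff_derivable/differentiable_aug_lagrangian.
move=> t t01; have := convex_function_segment f x z t convex_f t01.
rewrite /aug_lagrangian /lagrangian !sqr_enorm mulmxDr -scalemxAr.
rewrite -(addrA _ (A *m x)).
have -> : A *m z - b = A *m (z - x) + (A *m x - b).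
  by rewrite mulmxBr addrA subrK.
move: (A *m (z - x)) (A *m x - b) => w g; rewrite !dotE (dotC g w).
lra.
Qed.

Lemma dual_le_lagrangian mu z : Z z -> dual f A b Z mu <= lagrangian f A b z mu.
Proof.
by move=> Zz; apply: min_over_le => // x; exact: differentiable_lagrangian.
Qed.

(* The minimizer [z] of the augmented Lagrangian at an optimal multiplier is
   feasible: it also minimizes the ordinary Lagrangian at the shifted
   multiplier, whose dual value thus exceeds the optimum by [rho |A z - b|^2]. *)
Lemma dual_optimal_attained mu :
  Z !=set0 -> dual_optimal f A b Z mu ->
  exists2 z, Z z & A *m z = b /\ f z <= dual f A b Z mu.
Proof.
move=> Z0 opt; pose L z := aug_lagrangian f A b rho z mu.
have cL : {within Z, continuous L}.
  apply: continuous_subspaceT => x; apply: differentiable_continuous.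
  exact: differentiable_aug_lagrangian.
have [c] := compact_EVT_min Z0 compact_Z cL; rewrite inE => Zc Lc.
pose mu' := mu + rho *: (A *m c - b).
have cmin z : Z z -> lagrangian f A b c mu' <= lagrangian f A b z mu'.
  move=> Zz; rewrite -subr_ge0.
  apply: le_trans (derive_aug_lagrangian_le mu c z).
  apply: derive_ge0_of_min.
    exact/diff_derivable/differentiable_aug_lagrangian.
  by move=> t t01; apply: Lc; rewrite inE; exact: convex_set_segment.
have dual_mu' : lagrangian f A b c mu' <= dual f A b Z mu'.
  apply: lb_le_inf => [|_ [z Zz <-]]; last exact: cmin.
  by exists (lagrangian f A b c mu'), c.
(* With [g = A c - b], the chain is L(c, mu) + rho |g|^2 = L(c, mu') <= dual mu' <= dual mu <= L(c,
   mu), which forces [g = 0]. *)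
have := dual_le_lagrangian mu c Zc; have := opt mu'; move: dual_mu'.
rewrite /lagrangian /mu' dotDl dotZl => h1 h2 h3.
have g0 : A *m c - b = 0.
  apply: dotvv_eq0; apply/eqP; rewrite eq_le dotvv_ge0 andbT.
  by rewrite -(ler_pM2l rho_gt0) mulr0; lra.
exists c => //; split; first by apply/eqP; rewrite -subr_eq0 g0.
by move: h1 h2; rewrite g0 !dot0r mulr0 !addr0; exact: le_trans.
Qed.

(** Testing at a feasible [z] with [f z <= dual mu_star] bounds [-eps] by f z - f x - <mu + rho g,
    g>, where [g = A x - b]; the dual bound f z <= f x + <mu_star, g> then eliminates [f]. *)
Lemma inexact_dual_step mu_star mu x (eps : R) :
  Z !=set0 -> dual_optimal f A b Z mu_star -> Z x ->
  - eps <= min_over Z (fun z =>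
    dot (grad_aug_lagrangian f A b rho x mu) (z - x)) ->
  dot (mu - mu_star) (A *m x - b) + rho * dot (A *m x - b) (A *m x - b) <= eps.
Proof.
move=> Z0 opt Zx hx.
have [z Zz [Az fz]] := dual_optimal_attained mu_star Z0 opt.
have hz : - eps <= dot (grad_aug_lagrangian f A b rho x mu) (z - x).
  by apply: le_trans hx _; exact: min_over_dot_le.
have := dual_le_lagrangian mu_star x Zx.
have := derive_aug_lagrangian_le mu x z.
rewrite -dot_grad; last exact: differentiable_aug_lagrangian.
rewrite -/(grad_aug_lagrangian f A b rho x mu) /lagrangian Az subrr dot0r.
move: (A *m x - b) hz fz => g; rewrite !dotE; lra.
Qed.

End Duality.

(** * Telescoping along the dual iterates *)

Section Iteration.
Context {R : realType} {m n : nat}.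
Variables (A : 'M[R]_(m, n)) (b : 'cV[R]_m) (zbar : 'cV[R]_m -> 'cV[R]_n).
Variables (lambda : nat -> 'cV[R]_m) (alpha : nat -> R).
Hypothesis lambdaS : forall k, lambda k.+1 =
  lambda k + alpha k *: inexact_dual_grad A b zbar (lambda k).

(** The residual is affine, so the weighted average of the residuals is the residual of the average,
    and the weighted residuals are the increments of [lambda]. *)
Lemma residual_zhat k : stepsum alpha k != 0 ->
  stepsum alpha k *: (A *m zhat zbar alpha lambda k - b) =
  lambda k.+1 - lambda 0%N.
Proof.
move=> S0; rewrite /zhat -scalemxAr scalerBr scalerA divff// scale1r.
rewrite /stepsum; elim: k {S0} => [|k IH].
  rewrite !big_ord1 lambdaS /inexact_dual_grad scalerBr -scalemxAr.
  by rewrite [lambda 0%N + _]addrC addrK.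
rewrite big_ord_recr [in X in _ - X]big_ord_recr /= mulmxDr scalerDl opprD.
rewrite addrACA IH (lambdaS k.+1) /inexact_dual_grad scalerBr -scalemxAr.
by rewrite addrAC.
Qed.

Lemma sqr_dist_dual_iterates (mu : 'cV[R]_m) (eps : R) k :
  (forall j, enorm (lambda j.+1 - mu) ^+ 2 <=
    enorm (lambda j - mu) ^+ 2 + 2 * alpha j * eps) ->
  enorm (lambda k.+1 - mu) ^+ 2 <=
  enorm (lambda 0%N - mu) ^+ 2 + 2 * stepsum alpha k * eps.
Proof.
move=> step; rewrite /stepsum; elim: k => [|k IH]; first by rewrite big_ord1.
rewrite big_ord_recr /=; have := step k.+1; move: IH; lra.
Qed.

End Iteration.

(** * The feasibility bound for the averaged iterates *)

Theorem theorem3p3 (R : realType) (m n : nat)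
    (f : 'cV[R]_n -> R) (A : 'M[R]_(m, n)) (b : 'cV[R]_m) (Z : set 'cV[R]_n)
    (rho eps_in Lp Lund : R)
    (zbar : 'cV[R]_m -> 'cV[R]_n) (lambda_star : 'cV[R]_m)
    (lambda : nat -> 'cV[R]_m) (alpha : nat -> R)
    (Rp := diameter Z) (Ld := rho^-1)
    (Rd := enorm (lambda 0%N - lambda_star)) :
  convex_function [set: 'cV[R]_n] f ->
  (forall z, differentiable f z) ->
  row_free A ->
  Z !=set0 -> compact Z -> convex_set Z ->
  0 < rho -> 0 < eps_in ->
  0 < Lp ->
  (forall (mu : 'cV[R]_m) (z y : 'cV[R]_n),
     enorm (grad_aug_lagrangian f A b rho z mu
            - grad_aug_lagrangian f A b rho y mu) <= Lp * enorm (z - y)) ->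
  slater A b Z ->
  dual_optimal f A b Z lambda_star ->
  Ld <= Lund ->
  (forall mu : 'cV[R]_m, Z (zbar mu)) ->
  (forall mu : 'cV[R]_m,
     - inexactness Lp Rp eps_in <=
     min_over Z (fun z =>
       dot (grad_aug_lagrangian f A b rho (zbar mu) mu) (z - zbar mu))) ->
  (forall k, Lund^-1 <= alpha k <= Ld^-1) ->
  (forall k, lambda k.+1 =
     lambda k + alpha k *: inexact_dual_grad A b zbar (lambda k)) ->
  forall k : nat, (1 <= k)%N ->
    enorm (A *m zhat zbar alpha lambda k - b) <= nu Lund Lp Rp Rd k eps_in.
Proof.
move=> cf df _ Z0 cZ convZ rho0 _ _ _ _ opt LdL Zzbar VI alphaP lambdaS k _.
rewrite /nu; move: (inexactness Lp Rp eps_in) VI => eps VI.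
have Ld0 : 0 < Ld by rewrite invr_gt0.
have L0 : 0 < Lund := lt_le_trans Ld0 LdL.
have alpha_gt0 j : 0 < alpha j.
  by have /andP[+ _] := alphaP j; apply: lt_le_trans; rewrite invr_gt0.
have alpha_le j : alpha j <= rho by have /andP[_] := alphaP j; rewrite invrK.
have stepP j := inexact_dual_step f A b Z rho cf df cZ convZ rho0 lambda_star
  (lambda j) (zbar (lambda j)) eps Z0 opt (Zzbar _) (VI _).
have sqr_step j : enorm (lambda j.+1 - lambda_star) ^+ 2 <=
    enorm (lambda j - lambda_star) ^+ 2 + 2 * alpha j * eps.
  rewrite lambdaS addrAC !sqr_enorm /inexact_dual_grad.
  have := stepP j; move: (lambda j - lambda_star) (A *m _ - b) => u g.
  rewrite !dotE (dotC g u) => h.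
  (* Expanding the square leaves [alpha j ^+ 2 * dot g g], which [alpha j <= rho] lets the term -2
     alpha_j rho |g|^2 from [h] absorb. *)
  have a0 := alpha_gt0 j; have ar := alpha_le j; have g0 := dotvv_ge0 g.
  have h1 := ler_wpM2l (ltW a0) h.
  have h2 : alpha j * (alpha j * dot g g) <= alpha j * (rho * dot g g).
    by rewrite ler_pM2l// ler_wpM2r.
  have h3 : 0 <= alpha j * (rho * dot g g).
    by rewrite !mulr_ge0// ltW.
  lra.
(* The test point [zbar 0] itself makes the inner product vanish. *)
have eps0 : 0 <= eps.
  have := VI 0; rewrite -oppr_le0; move/le_trans; apply.
  rewrite -[leRHS](dot0r (grad_aug_lagrangian f A b rho (zbar 0) 0)).
  by rewrite -(subrr (zbar 0)); exact: min_over_dot_le.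
set S := stepsum alpha k.
(* [stepsum alpha k] has [k.+1] terms, each at least [Lund^-1]. *)
have S_ge : k.+1%:R / Lund <= S.
  rewrite /S /stepsum mulr_natl -[X in _ *+ X](card_ord k.+1) -sumr_const.
  by apply: ler_sum => j _; have /andP[] := alphaP j.
have kL0 : 0 < k.+1%:R / Lund by rewrite divr_gt0// ltr0n.
have S0 : 0 < S := lt_le_trans kL0 S_ge.
have SV : S^-1 <= Lund / k.+1%:R.
  by rewrite -[leRHS]invrK invf_div lef_pV2.
(* After squaring, the right side exceeds the telescoped bound by the nonnegative cross term. *)
have dist : enorm (lambda k.+1 - lambda_star) <= Rd + Num.sqrt (2 * S * eps).
  have Se0 : 0 <= 2 * S * eps by rewrite !mulr_ge0// ltW.
  have s0 := sqrtr_ge0 (2 * S * eps); have Rd0 : 0 <= Rd := enorm_ge0 _.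
  rewrite -(@ler_pXn2r _ 2)// ?nnegrE ?addr_ge0 ?enorm_ge0//.
  have := @sqr_dist_dual_iterates _ _ lambda alpha lambda_star eps k sqr_step.
  rewrite -/S -/Rd sqrrD (sqr_sqrtr Se0) => /le_trans; apply.
  have := mulr_ge0 Rd0 s0; lra.
(* The second [Rd] comes from passing through [lambda_star] in the triangle inequality. *)
have tri : S * enorm (A *m zhat zbar alpha lambda k - b) <=
    2 * Rd + Num.sqrt (2 * S * eps).
  rewrite -enormZ ?(ltW S0)// (residual_zhat _ _ _ _ _ lambdaS) ?gt_eqF//.
  have -> : lambda k.+1 - lambda 0%N =
      (lambda k.+1 - lambda_star) + - (lambda 0%N - lambda_star).
    by rewrite opprB addrA subrK.
  apply: le_trans (enormD _ _) _; rewrite enormN -/Rd; move: dist; lra.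
have {tri} : enorm (A *m zhat zbar alpha lambda k - b) <=
    S^-1 * (2 * Rd + Num.sqrt (2 * S * eps)) by rewrite ler_pdivlMl.
move/le_trans; apply; rewrite mulrDr lerD//.
  rewrite (_ : 2 * Lund * _ / _ = Lund / k.+1%:R * (2 * Rd)); last first.
    by ring.
  by rewrite ler_wpM2r// mulr_ge0// enorm_ge0.
(* Moving [S^-1] under the root turns the term into the root of [S^-1 * (2 * eps)], so the upper
   bound [SV] suffices. *)
rewrite -[S^-1]ger0_norm ?invr_ge0 ?(ltW S0)// -sqrtr_sqr -sqrtrM ?sqr_ge0//.
apply: ler_wsqrtr.
rewrite (_ : S^-1 ^+ 2 * _ = S^-1 * (2 * eps)); last by field; rewrite gt_eqF.
rewrite (_ : 2 * Lund * _ / _ = Lund / k.+1%:R * (2 * eps)); last first.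
  by ring.
by rewrite ler_wpM2r// mulr_ge0.
Qed.
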